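(* Let $S_X,S_\epsilon\in L_1(\mathbb R)$ be the power spectral densities of independent zero-mean real stationary Gaussian processes $X(\cdot)$ and $\epsilon(\cdot)$, and let $S_{X|X_\epsilon}$, $D_{X|X_\epsilon}$ and $D^\star$ be as defined in the context. Let $(R,D)$ be a point on the graph of $D_{X|X_\epsilon}(\cdot)$ and let $\theta>0$ be the associated water-level, i.e. $R=\frac12\int_{-\infty}^\infty\log^+[S_{X|X_\epsilon}(f)/\theta]\,df$ and $D=D_{X|X_\epsilon}(R)$. Define $$F_\theta=\{f\in\mathbb R: S_{X|X_\epsilon}(f)>\theta\},\qquad f_R=\mu(F_\theta),$$ where $\mu$ is Lebesgue measure. Then for all $f_s\ge f_R$, $$D^\star(f_s,R)=D_{X|X_\epsilon}(R).$$
   Context: $\sigma_X^2=\int_{-\infty}^\infty S_X(f)\,df$ is the variance of $X(\cdot)$, and $$S_{X|X_\epsilon}(f)=\frac{S_X^2(f)}{S_X(f)+S_\epsilon(f)}$$ (taken as $0$ where $S_X(f)=0$; the case $S_\epsilon\equiv0$ is allowed). $\log$ is to base 2, $x^+=\max\{x,0\}$, $\log^+x=\max\{\log x,0\}$. The indirect distortion-rate function of $X(\cdot)$ given $X_\epsilon(\cdot)=X(\cdot)+\epsilon(\cdot)$ is given parametrically in $\theta>0$ by $$D_{X|X_\epsilon}(R_\theta)=\sigma_X^2-\int_{-\infty}^\infty S_{X|X_\epsilon}(f)\,df+\int_{-\infty}^\infty\min\{S_{X|X_\epsilon}(f),\theta\}\,df,\qquad R_\theta=\frac12\int_{-\infty}^\infty\log^+\big[S_{X|X_\epsilon}(f)/\theta\big]df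 .$$ For $f_s$ and $R$: let $F^\star_{f_s}$ be a set with $\mu(F^\star_{f_s})\le f_s$ that maximizes $\int_F S_{X|X_\epsilon}(f)\,df$ over all measurable $F\subset\mathbb R$ with $\mu(F)\le f_s$. Then $$D^\star(f_s,R)=\sigma_X^2-\int_{F^\star_{f_s}}\big[S_{X|X_\epsilon}(f)-\theta'\big]^+df,$$ where $\theta'>0$ is determined by $R=\frac12\int_{F^\star_{f_s}}\log^+\big[S_{X|X_\epsilon}(f)/\theta'\big]df$. *)

(* Defs.v *)
From HB Require Import structures.
From mathcomp Require Export all_boot all_order all_algebra.
From mathcomp Require Export all_classical all_reals all_analysis.

Set Implicit Arguments.
Unset Strict Implicit.
Unset Printing Implicit Defensive.

Import Order.TTheory GRing.Theory Num.Theory.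
Import numFieldNormedType.Exports.

Local Open Scope classical_set_scope.
Local Open Scope ring_scope.

Section processes.
Context {R : realType} {d : measure_display} {T : measurableType d}.
Variable P : probability T R.
Implicit Types X Y : R -> {RV P >-> R}.

(* Every finite linear combination of the X t is Gaussian.  Degenerate
   (constant) combinations are allowed; they are treated apart because
   [normal_prob m 0] is not the Dirac mass at m in the library. *)
Definition gaussian_process X :=
  forall (n : nat) (a t : 'I_n -> R), exists m s : R, 0 <= s /\
    forall A : set R, measurable A ->
      P ((fun w => \sum_(i < n) a i * X (t i) w) @^-1` A) =
      if s == 0 then \d_m A else normal_prob m s A.

Definition zero_mean X := forall t, ('E_P[X t] = 0)%E.

(* Shift-invariance of the finite-dimensional distributions, which are
   determined by their values on measurable rectangles. *)
Definition stationary X :=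
  forall (tau : R) (n : nat) (t : 'I_n -> R) (A : 'I_n -> set R),
    (forall i, measurable (A i)) ->
    P [set w | forall i, A i (X (t i + tau) w)] =
    P [set w | forall i, A i (X (t i) w)].

Definition process_events X : set_system T :=
  <<s [set B | exists t (A : set R), measurable A /\ B = X t @^-1` A] >>.

Definition independent_processes X Y :=
  forall A B, process_events X A -> process_events Y B ->
    P (A `&` B) = (P A * P B)%E.

(* S is the power spectral density of X: an L1 function whose Fourier
   transform int S(f) exp(2 i pi f tau) df is the autocovariance of X; its
   real and imaginary parts are written separately. *)
Definition is_psd X (S : R -> R) :=
  [/\ forall f, 0 <= S f,
      lebesgue_measure.-integrable setT (EFin \o S),
      forall t tau, covariance P (X (t + tau)) (X t) =
        (\int[lebesgue_measure]_f (S f * cos (2 * pi * f * tau)))%:E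
    & forall tau,
        \int[lebesgue_measure]_f (S f * sin (2 * pi * f * tau)) = 0].

End processes.

Section distortion_rate.
Context {R : realType}.
Notation mu := (@lebesgue_measure R).
Implicit Types (SX Se S : R -> R) (F : set R).

Definition log2 (x : R) : R := ln x / ln 2.

(* In the library ln 0 = 0, hence logp 0 = 0, as with log 0 = -oo. *)
Definition logp (x : R) : R := Num.max (log2 x) 0.

Definition posp (x : R) : R := Num.max x 0.

Definition variance_psd SX : R := \int[mu]_f SX f.

Definition cond_psd SX Se (f : R) : R :=
  if SX f == 0 then 0 else SX f ^+ 2 / (SX f + Se f).

Definition waterfill_rate S F (theta : R) : R :=
  2^-1 * \int[mu]_(f in F) logp (S f / theta).

(* The parametric curve theta |-> (R_theta, D(R_theta)), theta > 0. *)
Definition idrf_rate SX Se (theta : R) : R :=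
  waterfill_rate (cond_psd SX Se) setT theta.

Definition idrf_dist SX Se (theta : R) : R :=
  variance_psd SX - \int[mu]_f cond_psd SX Se f
  + \int[mu]_f Num.min (cond_psd SX Se f) theta.

Definition is_idrf SX Se (r D : R) :=
  exists theta, [/\ 0 < theta, r = idrf_rate SX Se theta
                  & D = idrf_dist SX Se theta].

(* D_{X|X_eps}(r); [get] picks an element of the set, if there is one. *)
Definition idrf SX Se (r : R) : R := get [set D | is_idrf SX Se r D].

Definition is_Fstar S (fs : R) F :=
  [/\ measurable F, (mu F <= fs%:E)%E
    & forall G : set R, measurable G -> (mu G <= fs%:E)%E ->
        \int[mu]_(f in G) S f <= \int[mu]_(f in F) S f].

Definition is_Dstar SX Se (fs r D : R) :=
  exists F theta', [/\ is_Fstar (cond_psd SX Se) fs F, 0 < theta',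
    r = waterfill_rate (cond_psd SX Se) F theta'
    & D = variance_psd SX
          - \int[mu]_(f in F) posp (cond_psd SX Se f - theta')].

Definition Dstar SX Se (fs r : R) : R := get [set D | is_Dstar SX Se fs r D].

Definition superlevel S (theta : R) : set R := [set f | theta < S f].

End distortion_rate.

(* Main.v *)
(* Write S for the conditional density.  A maximizing F exists by the bathtub
   principle: Lebesgue measure has no atoms, so one can take F between the sets
   {S > t} and {S >= t} for a suitable t, with measure fs unless t = 0.
   Comparing with this set, any maximizer contains almost all of {S > t}, and
   t <= theta as mu {S > theta} <= fs.  Hence S <= theta a.e. off any maximizer
   F, so restricting to F changes neither the rate nor the integral of
   (S - theta)^+ .  Finally, two water levels with the same rate on a set F
   have the same integral of (S - level)^+ over F, because the integrands of
   the rates are monotone in the level and so agree a.e.; this makes the values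
   of both distortion functions independent of the level chosen. *)
From mathcomp Require Import measurable_realfun.
Require Import Defs.

Set Implicit Arguments.
Unset Strict Implicit.
Unset Printing Implicit Defensive.

Import Order.TTheory GRing.Theory Num.Theory.
Import numFieldNormedType.Exports.

Local Open Scope classical_set_scope.
Local Open Scope ring_scope.

Local Notation mu := lebesgue_measure.

(** * Subsets of prescribed Lebesgue measure *)

(* The mass of A `&` [-n, x] depends continuously on x. *)
Lemma exists_subset_lebesgue_measure (R : realType) (A : set R) (c : R) :
  measurable A -> 0 <= c -> (c%:E <= mu A)%E ->
  exists B, [/\ measurable B, B `<=` A & mu B = c%:E].
Proof.
move=> mA c0; rewrite le_eqVlt => /predU1P[cA|cA]; first by exists A; split.
pose K (n : nat) : set R := `[- n%:R, n%:R]%classic.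
have mK n : measurable (K n) by exact: measurable_itv.
(* The windows [K n] exhaust the line, so if every [A] cut to [K n] had mass at most [c], continuity
   from below would give mass at most [c] to [A] itself. The equality case, settled above, makes the
   strict inequality available. *)
have [n cAn] : exists n, (c%:E < mu (A `&` K n))%E.
  have [//|/forallNP small] := pselect (exists n, (c%:E < mu (A `&` K n))%E).
  suff : (mu A <= c%:E)%E by rewrite leNgt cA.
  have cupA : \bigcup_n (A `&` K n) = A.
    by rewrite -setI_bigcupr bigcup_itvT setIT.
  have mAK i : measurable (A `&` K i) by exact: measurableI.
  rewrite -[in leLHS]cupA.
  have := @nondecreasing_cvg_mu _ _ _ mu (fun n => A `&` K n).
  move=> /(_ mAK); rewrite cupA => /(_ mA) AK.
  apply: (cvge_le _ (AK _)).
    by apply: nearW => i /=; rewrite leNgt; exact/negP/small.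
  move=> i j ij; apply/subsetPset; apply: setIS; apply: subset_itv;
    by rewrite leBSide/= ?lerN2 ler_nat.
have n0 : - n%:R <= n%:R :> R by rewrite -subr_ge0 opprK addr_ge0.
have Kfin : (mu (K n) < +oo)%E.
  by rewrite lebesgue_measure_itv/=; case: ifP => // _; rewrite -EFinB ltry.
have mAK (L : set R) : measurable L -> measurable (A `&` L).
  exact: measurableI.
have intA : mu.-integrable (K n) (EFin \o \1_A).
  apply/integrableP; split.
    by apply/measurable_EFinP; exact: measurable_indic.
  under eq_integral do rewrite /= ger0_norm//.
  rewrite integral_indic//; last exact: (mK n).
  apply: (le_lt_trans _ Kfin).
  apply: le_measure; rewrite ?inE; last exact: subIsetr.
    exact: (mAK _ (mK n)).
  exact: (mK n).
have massE x : x <= n%:R ->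
    (parameterized_integral mu (- n%:R) x \1_A)%:E = mu (A `&` `[- n%:R, x]).
  move=> xn; rewrite /parameterized_integral /Rintegral fineK integral_indic//.
  rewrite ge0_fin_numE//; apply: (le_lt_trans _ Kfin); apply: le_measure.
  - by rewrite inE; exact: mAK.
  - by rewrite inE; exact: (mK n).
  - by move=> y [_]; apply: subset_itv; rewrite bnd_simp.
(* The mass is 0 at [x = -n] and exceeds [c] at [x = n]. *)
have [] := @IVT R (parameterized_integral mu (- n%:R) ^~ \1_A) (- n%:R) n%:R c
  n0 (parameterized_integral_continuous n0 intA).
  apply/andP; split; rewrite ?ge_min ?le_max; apply/orP; [left|right].
  - by rewrite /parameterized_integral set_itv1 Rintegral_set1.
  - by rewrite -lee_fin massE// ltW.
move=> x; rewrite in_itv/= => /andP[_ xn] hx.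
exists (A `&` `[- n%:R, x]); split; first exact: mAK.
  exact: subIsetl.
by rewrite -massE// hx.
Qed.

(** * Inequalities for the positive part of the logarithm *)

Lemma logp_ge0 (R : realType) (x : R) : 0 <= logp x.
Proof. by rewrite le_max lexx orbT. Qed.

Lemma ln2_gt0 (R : realType) : 0 < ln 2 :> R.
Proof. by rewrite ln_gt0// ltr1n. Qed.

(** Follows from [ln x < x] for positive [x], and from [ln 0 = 0] at the origin. It dominates the
    rate integrand by a multiple of the density, whence its integrability. *)
Lemma le_logp_linear (R : realType) (x : R) : 0 <= x -> logp x <= x / ln 2.
Proof.
move=> x0; rewrite ge_max divr_ge0 ?(ltW (ln2_gt0 _))// andbT.
rewrite ler_pM2r ?invr_gt0 ?ln2_gt0//; move: x0; rewrite le_eqVlt.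
by case/predU1P => [<-|x0]; [rewrite ln0|exact/ltW/ln_sublinear].
Qed.

Lemma le_logp_div (R : realType) (s a b : R) :
  0 <= s -> 0 < a -> a <= b -> logp (s / b) <= logp (s / a).
Proof.
move=> s0 a0 ab; have b0 := lt_le_trans a0 ab; rewrite /logp /log2.
move: s0; rewrite le_eqVlt => /predU1P[<-|s0]; first by rewrite !mul0r.
rewrite ge_max !le_max lexx orbT andbT ler_pM2r ?invr_gt0 ?ln2_gt0//.
by rewrite ler_ln ?posrE ?divr_gt0// ler_pM2l// lef_pV2 ?posrE// ab.
Qed.

(* Strict monotonicity of log: the two levels can only give the same rate at
   a frequency that lies below both of them. *)
Lemma posp_eq_of_logp_eq (R : realType) (s a b : R) :
  0 <= s -> 0 < a -> a <= b -> logp (s / a) = logp (s / b) ->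
  posp (s - a) = posp (s - b).
Proof.
move=> s0 a0; rewrite le_eqVlt => /predU1P[-> //|ab].
have b0 := lt_trans a0 ab; have [sa _|as_] := leP s a.
  by rewrite /posp !max_r// subr_le0// (le_trans sa (ltW ab)).
have s_gt0 := lt_trans a0 as_.
have lt_log : log2 (s / b) < log2 (s / a).
  rewrite ltr_pM2r ?invr_gt0 ?ln2_gt0// ltr_ln ?posrE ?divr_gt0//.
  by rewrite ltr_pM2l// ltf_pV2 ?posrE.
have log_gt0 : 0 < log2 (s / a).
  by rewrite divr_gt0 ?ln2_gt0// ln_gt0// ltr_pdivlMr// mul1r.
rewrite /logp (max_l (ltW log_gt0)) => abs.
have : Num.max (log2 (s / b)) 0 < log2 (s / a) by rewrite gt_max lt_log.
by rewrite -abs ltxx.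
Qed.

(** * Domination and almost-everywhere arguments for integrals *)

Section integration.
Context d (T : measurableType d) (R : realType) (m : {measure set T -> \bar R}).
Implicit Types (F : set T) (f g S : T -> R).

Lemma integrable_le_scale F f S (c : R) : measurable F ->
  measurable_fun setT f -> m.-integrable setT (EFin \o S) ->
  (forall x, `|f x| <= c * S x) -> m.-integrable F (EFin \o f).
Proof.
move=> mF mf iS fS.
apply: (@le_integrable _ _ _ _ _ mF _ (fun x => c%:E * (S x)%:E)%E).
- by apply/measurable_EFinP; exact: measurable_funTS.
- move=> x _; rewrite /= lee_fin.
  by rewrite (le_trans (fS x))// ler_norm.
- by apply: integrableZl => //; exact: (integrableS measurableT).
Qed.

Lemma integrable_cst_lty F (c : R) : measurable F -> (m F < +oo)%E ->
  m.-integrable F (EFin \o cst c).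
Proof.
move=> mF Foo; apply/integrableP; split.
  by apply/measurable_EFinP; exact: measurable_cst.
by rewrite /= integral_cst// lte_mul_pinfty.
Qed.

Lemma integrable_patch F f : measurable F ->
  m.-integrable F (EFin \o f) -> m.-integrable setT (EFin \o (f \_ F)).
Proof. by move=> mF /(integrable_mkcond _ mF); rewrite restrict_EFin. Qed.

(** The difference [f - g] is nonnegative on [F] with zero integral, so it vanishes almost
    everywhere there. *)
Lemma ae_eq_of_le_Rintegral_eq F f g : measurable F ->
  m.-integrable F (EFin \o f) -> m.-integrable F (EFin \o g) ->
  (forall x, F x -> g x <= f x) ->
  \int[m]_(x in F) f x = \int[m]_(x in F) g x ->
  {ae m, forall x, F x -> f x = g x}.
Proof.
move=> mF if_ ig gf fg.
have ifg : m.-integrable F (EFin \o (f \- g)).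
  apply: eq_integrable (integrableB mF if_ ig) => //.
have /ae_eq_integral_abs : measurable_fun F (EFin \o (f \- g)).
  exact: measurable_int ifg.
move=> /(_ m mF)[+ _].
have -> : (\int[m]_(x in F) `|(EFin \o (f \- g)%R) x| = 0)%E.
  rewrite (eq_integral (EFin \o (f \- g))); last first.
    by move=> x /set_mem xF; rewrite /= ger0_norm// subr_ge0 gf.
  rewrite -[LHS]fineK ?integrable_fin_num//.
  congr EFin; rewrite -[LHS]/(\int[m]_(x in F) (f x - g x)).
  by rewrite RintegralB// fg subrr.
move=> /(_ erefl); apply: filterS => x /[apply] -[] /eqP.
by rewrite subr_eq0 => /eqP.
Qed.

Lemma ae_eq_Rintegral F f g : measurable F ->
  measurable_fun F f -> measurable_fun F g ->
  {ae m, forall x, F x -> f x = g x} ->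
  \int[m]_(x in F) f x = \int[m]_(x in F) g x.
Proof.
move=> mF mf mg fg; congr fine; apply: ae_eq_integral => //.
- exact/measurable_EFinP.
- exact/measurable_EFinP.
- by apply: filterS fg => x /[apply] /= ->.
Qed.

Lemma Rintegral_ae_support F f : measurable F -> measurable_fun setT f ->
  {ae m, forall x, ~ F x -> f x = 0} ->
  \int[m]_(x in F) f x = \int[m]_x f x.
Proof.
move=> mF mf f0; rewrite Rintegral_mkcond; apply: ae_eq_Rintegral => //.
  exact/(measurable_restrictT _ mF)/measurable_funTS.
apply: filterS f0 => x; rewrite patchE; case: ifPn => // /negP xF /(_ _) -> //.
by move=> Fx; apply: xF; rewrite inE.
Qed.

End integration.

(** * Level sets and the bathtub construction *)

Section bathtub.
Context {R : realType}.
Implicit Types (S : R -> R) (F : set R) (t c theta : R).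

Lemma measurable_superlevel S t :
  measurable_fun setT S -> measurable (superlevel S t).
Proof.
move=> mS; have -> : superlevel S t = setT `&` S @^-1` `]t, +oo[.
  by rewrite setTI; apply/seteqP; split => x /=; rewrite in_itv/= andbT.
exact: mS.
Qed.

Lemma measurable_ge_level S t :
  measurable_fun setT S -> measurable [set x | t <= S x].
Proof.
move=> mS; have -> : [set x | t <= S x] = setT `&` S @^-1` `[t, +oo[.
  by rewrite setTI; apply/seteqP; split => x /=; rewrite in_itv/= andbT.
exact: mS.
Qed.

Lemma le_superlevel S : {homo superlevel S : s t / s <= t >-> t `<=` s}.
Proof. by move=> s t st x; exact: le_lt_trans. Qed.

(** Markov's inequality. *)
Lemma superlevel_lty S t : mu.-integrable setT (EFin \o S) -> 0 < t ->
  (mu (superlevel S t) < +oo)%E.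
Proof.
move=> iS t0; have mS : measurable_fun setT S.
  by apply/measurable_EFinP; exact: measurable_int iS.
have /integrableP[mES Soo] := iS.
have := le_integral_abse mu measurableT mES t0.
move=> /le_lt_trans/(_ Soo); rewrite setTI; set A := [set x | _] => Aoo.
apply: (@le_lt_trans _ _ (mu A)).
  apply: le_measure; rewrite ?inE.
  - exact: measurable_superlevel.
  - rewrite /A; have -> : [set x | (t%:E <= `|(EFin \o S) x|)%E] =
      [set x | t <= `|S x|] by [].
    by apply: measurable_ge_level; exact: measurableT_comp.
  - by move=> x tx; rewrite /A/= lee_fin (le_trans (ltW tx))// ler_norm.
rewrite ltey; apply/eqP => muA; have : (t%:E * mu A < +oo)%E := Aoo.
by rewrite muA gt0_muley ?lte_fin// ltxx.
Qed.

(** Continuity from below along the levels [t + 1/(n+1)], which decrease to [t]. *)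
Lemma superlevel_inf S t c : measurable_fun setT S ->
  (forall s, t < s -> (mu (superlevel S s) <= c%:E)%E) ->
  (mu (superlevel S t) <= c%:E)%E.
Proof.
move=> mS St; pose F n := superlevel S (t + n.+1%:R^-1).
have FE : \bigcup_n F n = superlevel S t.
  apply/seteqP; split => [x [n _]|x /= tx].
    by apply: le_lt_trans; rewrite lerDl.
  have /ltr_add_invr[n tn] : t < S x by [].
  by exists n.
have mF n : measurable (F n) by exact: measurable_superlevel.
have ndF : nondecreasing_seq F.
  move=> i j ij; apply/subsetPset/le_superlevel.
  by rewrite lerD2l lef_pV2 ?posrE// ler_nat.
have muF : mu (F n) @[n --> \oo] --> mu (superlevel S t).
  rewrite -FE; apply: nondecreasing_cvg_mu => //.
  by rewrite FE; exact: measurable_superlevel.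
by apply: cvge_le muF; apply: nearW => n; apply: St; rewrite ltrDl.
Qed.

(** Continuity from above along levels increasing to [t]; the measures are finite because these
    levels are positive. *)
Lemma ge_level_sup S t c : mu.-integrable setT (EFin \o S) -> 0 < t ->
  (forall s, 0 < s -> s < t -> (c%:E <= mu (superlevel S s))%E) ->
  (c%:E <= mu [set x | (t <= S x)%R])%E.
Proof.
move=> iS t0 St; have mS : measurable_fun setT S.
  by apply/measurable_EFinP; exact: measurable_int iS.
(* With [n.+2] the level is positive already at [n = 0]. *)
pose s n : R := t * (1 - n.+2%:R^-1).
have s_gt0 n : 0 < s n by rewrite mulr_gt0// subr_gt0 invf_lt1// ltr1n.
have s_lt n : s n < t by rewrite gtr_pMr// gtrBl invr_gt0.
pose F n := superlevel S (s n).
have FE : \bigcap_n F n = [set x | t <= S x].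
  apply/seteqP; split => [x Fx /=|x /= tx n _]; last first.
    exact: lt_le_trans (s_lt n) tx.
  rewrite leNgt; apply/negP => xt.
  (* If [S x < t], some [1/(n+1)] is below the relative gap [(t - S x) / t], which puts [s n] above
     [S x]. *)
  have : 0 < (t - S x) / t by rewrite divr_gt0// subr_gt0.
  move=> /ltr_add_invr[n]; rewrite add0r ltr_pdivlMr// => nx.
  have := Fx n I; rewrite /F/superlevel/= /s.
  rewrite mulrBr mulr1 [t * _]mulrC ltrBlDl -ltrBlDr => Sx.
  suff : n.+2%:R^-1 * t <= n.+1%:R^-1 * t.
    by rewrite leNgt (lt_trans nx Sx).
  by rewrite ler_pM2r// lef_pV2 ?posrE// ler_nat.
have mF n : measurable (F n) by exact: measurable_superlevel.
have niF : nonincreasing_seq F.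
  move=> i j ij; apply/subsetPset/le_superlevel.
  by rewrite ler_pM2l// lerD2l lerN2 lef_pV2 ?posrE// ler_nat.
have muF : mu (F n) @[n --> \oo] --> mu [set x | (t <= S x)%R].
  rewrite -FE; apply: nonincreasing_cvg_mu => //.
    exact: superlevel_lty.
  by rewrite FE; exact: measurable_ge_level.
by apply: cvge_ge muF; apply: nearW => n; exact: St.
Qed.

(* The level sets of S strictly above t have measure at most c, those at or
   above t at least c; the part of [S = t] needed to reach c exactly is chosen
   arbitrarily. *)
Lemma bathtub_set S theta c : (forall x, 0 <= S x) ->
  mu.-integrable setT (EFin \o S) -> 0 < theta ->
  (mu (superlevel S theta) <= c%:E)%E ->
  exists t F, [/\ 0 <= t <= theta, measurable F,
    superlevel S t `<=` F, F `<=` [set x | t <= S x] &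
    (mu F <= c%:E)%E /\ (t = 0 \/ mu F = c%:E)].
Proof.
move=> S0 iS theta0 Stheta; have mS : measurable_fun setT S.
  by apply/measurable_EFinP; exact: measurable_int iS.
(* The level sought is the infimum of the levels whose superlevel set fits into measure [c]. *)
pose E := [set s | 0 <= s /\ (mu (superlevel S s) <= c%:E)%E].
have Etheta : E theta by split => //; exact: ltW.
have E_lb : has_lbound E by exists 0 => s [].
pose t := inf E.
have t_ge0 : 0 <= t by apply: lb_le_inf; [exists theta|move=> s []].
have t_le : t <= theta by exact: ge_inf.
have tc : (mu (superlevel S t) <= c%:E)%E.
  apply: superlevel_inf => // s /inf_lt[|r [_ rc] rs]; first by exists theta.
  apply: le_trans rc; apply: le_measure; rewrite ?inE;
    try exact: measurable_superlevel.
  exact/le_superlevel/ltW.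
have mSt := measurable_superlevel t mS.
move: t_ge0; rewrite le_eqVlt => /predU1P[t0|t_gt0].
  (* At level 0 the measure may stay below [c]: [S] vanishes off this set, so nothing is gained by
     enlarging it. *)
  exists 0, (superlevel S 0); rewrite lexx ltW//; split => //.
  - exact: measurable_superlevel.
  - by move=> x _; exact: S0.
  - by split; [rewrite t0|left].
have tc' : (c%:E <= mu [set x | (t <= S x)%R])%E.
  apply: ge_level_sup => // s s0 st; rewrite leNgt; apply/negP => /ltW sc.
  by move: st; rewrite ltNge ge_inf//; split => //; exact: ltW.
pose A := [set x | t <= S x] `\` superlevel S t.
have mA : measurable A by apply: measurableD => //; exact: measurable_ge_level.
have AE : [set x | t <= S x] = superlevel S t `|` A.
  by rewrite setDUK// => x /= /ltW.
have muAE : mu [set x | (t <= S x)%R] = (mu (superlevel S t) + mu A)%E.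
  by rewrite AE measureU// setDIK.
have St_fin : mu (superlevel S t) \is a fin_num.
  by rewrite ge0_fin_numE//; exact: superlevel_lty.
set u := fine (mu (superlevel S t)).
have uE : mu (superlevel S t) = u%:E by rewrite fineK.
(* The missing measure [c - u] is taken from the plateau [A], on which [S = t]. *)
have [||B [mB BA muB]] := @exists_subset_lebesgue_measure R A (c - u) mA.
- by rewrite subr_ge0 -lee_fin -uE.
- by rewrite EFinB leeBlDl// -uE -muAE.
exists t, (superlevel S t `|` B).
have muF : mu (superlevel S t `|` B) = c%:E.
  have -> : mu (superlevel S t `|` B) = (mu (superlevel S t) + mu B)%E.
    by apply: measureU => //; apply/seteqP; split => // x [tx /BA[]].
  by rewrite uE muB -EFinD addrCA subrr addr0.
rewrite ltW//; split => //.
- exact: measurableU.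
- by move=> x [/ltW//|/BA[]].
- by rewrite muF; split; [|right].
Qed.

End bathtub.

(** * Maximizing sets and water levels for a nonnegative integrable density *)

Section water_filling.
Context {R : realType}.
Context (S : R -> R) (S_ge0 : forall x, 0 <= S x).
Context (int_S : mu.-integrable setT (EFin \o S)).
Implicit Types (F G : set R) (t c theta : R).

Let meas_S : measurable_fun setT S.
Proof. by apply/measurable_EFinP; exact: measurable_int int_S. Qed.

Lemma measurable_posp_sub t : measurable_fun setT (fun x => posp (S x - t)).
Proof.
apply: (@measurable_maxr _ _ _ _ (fun x => S x - t) (cst 0)) => //.
exact: measurable_funB.
Qed.

Lemma integrable_posp_sub F t : measurable F -> 0 <= t ->
  mu.-integrable F (EFin \o (fun x => posp (S x - t))).
Proof.
move=> mF t0; apply: (@integrable_le_scale _ _ _ mu F _ S 1) => //.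
  exact: measurable_posp_sub.
move=> x; rewrite mul1r ger0_norm; last by rewrite le_max lexx orbT.
by rewrite ge_max S_ge0 andbT gerBl.
Qed.

Lemma measurable_logp_div t : measurable_fun setT (fun x => logp (S x / t)).
Proof.
apply: (@measurable_maxr _ _ _ _ (fun x => log2 (S x / t)) (cst 0)) => //.
apply: measurable_funM => //; apply: measurableT_comp => //.
exact: measurable_funM.
Qed.

Lemma integrable_logp_div F t : measurable F -> 0 < t ->
  mu.-integrable F (EFin \o (fun x => logp (S x / t))).
Proof.
move=> mF t0; apply: (@integrable_le_scale _ _ _ mu F _ S (t^-1 / ln 2)) => //.
  exact: measurable_logp_div.
move=> x; rewrite ger0_norm ?logp_ge0// mulrAC [t^-1 * _]mulrC.
by rewrite le_logp_linear// divr_ge0// ltW.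
Qed.

Lemma waterfill_rate_inj F t theta : measurable F -> 0 < t -> 0 < theta ->
  waterfill_rate S F t = waterfill_rate S F theta ->
  \int[mu]_(x in F) posp (S x - t) = \int[mu]_(x in F) posp (S x - theta).
Proof.
move=> mF; wlog le_t : t theta / t <= theta => [hwlog t0 theta0 rE|t0 theta0].
  have [le_t|/ltW le_t] := leP t theta; first exact: hwlog.
  by apply/esym; apply: hwlog.
move=> /mulfI rE; apply: ae_eq_Rintegral => //.
- by apply: measurable_funTS; exact: measurable_posp_sub.
- by apply: measurable_funTS; exact: measurable_posp_sub.
(* With [t <= theta] the integrands are ordered pointwise, so equal integrals force equality almost
   everywhere. *)
have : {ae mu, forall x, F x -> logp (S x / t) = logp (S x / theta)}.
  apply: ae_eq_of_le_Rintegral_eq => //.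
  - exact: integrable_logp_div.
  - exact: integrable_logp_div.
  - by move=> x _; exact: le_logp_div.
  - by apply: rE; rewrite invr_eq0 pnatr_eq0.
apply: filterS; first exact: (ae_filter_ringOfSetsType mu).
by move=> x /[apply]; exact: posp_eq_of_logp_eq.
Qed.

(** Integrates the pointwise bound of [S] by [posp (S - t) + t]. This is the upper bound of the
    bathtub principle. *)
Lemma Rintegral_le_posp_sub G t c : measurable G -> (mu G <= c%:E)%E ->
  0 <= t -> \int[mu]_(x in G) S x <= \int[mu]_(x in G) posp (S x - t) + t * c.
Proof.
move=> mG Gc t0; have Goo : (mu G < +oo)%E := le_lt_trans Gc (ltry c).
have iG : mu.-integrable G (EFin \o (fun x => posp (S x - t))).
  exact: integrable_posp_sub.
have it : mu.-integrable G (EFin \o cst t) by exact: integrable_cst_lty.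
apply: (@le_trans _ _ (\int[mu]_(x in G) (posp (S x - t) + t))).
  apply: le_Rintegral => //.
  - exact: integrableS int_S.
  - exact: (@integrableD _ _ R mu G mG _ _ iG it).
  - by move=> x _; rewrite -lerBlDr le_max lexx.
rewrite RintegralD// lerD2l Rintegral_cst// ler_wpM2l//.
by rewrite -lee_fin fineK// ge0_fin_numE.
Qed.

(** Equality case of the preceding bound: on [F] one has [S = posp (S - t) + t], off [F] the
    positive part vanishes, and the term [t * mu F] is [t * c] in either case of the last
    hypothesis. *)
Lemma Rintegral_bathtub F t c : measurable F -> 0 <= t ->
  superlevel S t `<=` F -> F `<=` [set x | t <= S x] ->
  (mu F <= c%:E)%E -> t = 0 \/ mu F = c%:E ->
  \int[mu]_(x in F) S x = \int[mu]_x posp (S x - t) + t * c.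
Proof.
move=> mF t0 StF FSt Fc Ft.
have Foo : (mu F < +oo)%E := le_lt_trans Fc (ltry c).
have iF : mu.-integrable F (EFin \o (fun x => posp (S x - t))).
  exact: integrable_posp_sub.
have it : mu.-integrable F (EFin \o cst t) by exact: integrable_cst_lty.
have <- : \int[mu]_(x in F) posp (S x - t) = \int[mu]_x posp (S x - t).
  apply: Rintegral_ae_support => //; first exact: measurable_posp_sub.
  apply: aeW => x Fx; rewrite /posp max_r// subr_le0 leNgt.
  by apply/negP => /StF.
have -> : \int[mu]_(x in F) S x = \int[mu]_(x in F) (posp (S x - t) + t).
  apply: eq_Rintegral => x /set_mem/FSt /= tSx.
  by rewrite /posp max_l ?subr_ge0// subrK.
rewrite RintegralD// Rintegral_cst//; congr (_ + _).
case: Ft => [->|Fc_eq]; first by rewrite !mul0r.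
by congr (_ * _); exact: (congr1 fine Fc_eq).
Qed.

Lemma Fstar_exists theta c : 0 < theta ->
  (mu (superlevel S theta) <= c%:E)%E -> exists F, is_Fstar S c F.
Proof.
move=> theta0 Stheta.
have [t [F [/andP[t0 _] mF StF FSt [Fc Ft]]]] :=
  bathtub_set S_ge0 int_S theta0 Stheta.
exists F; split => // G mG Gc.
rewrite (Rintegral_bathtub mF t0 StF FSt Fc Ft).
apply: le_trans (Rintegral_le_posp_sub mG Gc t0) _.
(* Only the integral of the nonnegative [posp (S - t)] over [G] is left to compare with that over
   the whole line. *)
rewrite lerD2r Rintegral_mkcond; apply: le_Rintegral => //.
- apply: integrable_patch => //.
  exact: integrable_posp_sub.
- exact: integrable_posp_sub.
- move=> x _; rewrite patchE; case: ifP => // _.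
  by rewrite le_max lexx orbT.
Qed.

Lemma Fstar_ae_le F theta c : 0 < theta ->
  (mu (superlevel S theta) <= c%:E)%E -> is_Fstar S c F ->
  {ae mu, forall x, ~ F x -> S x <= theta}.
Proof.
move=> theta0 Stheta [mF Fc Fmax].
have [t [F0 [/andP[t0 t_le] mF0 StF FSt [F0c F0t]]]] :=
  bathtub_set S_ge0 int_S theta0 Stheta.
pose g x := posp (S x - t).
have g0 x : 0 <= g x by rewrite le_max lexx orbT.
have igF : mu.-integrable setT (EFin \o (g \_ F)).
  apply: integrable_patch => //.
  exact: integrable_posp_sub.
have ig : mu.-integrable setT (EFin \o g) by exact: integrable_posp_sub.
have gF x : (g \_ F) x <= g x by rewrite patchE; case: ifP.
have : {ae mu, forall x, setT x -> g x = (g \_ F) x}.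
  apply: ae_eq_of_le_Rintegral_eq => //; apply/eqP.
  rewrite eq_le; apply/andP; split; last exact: le_Rintegral.
  (* After adding [t * c], the integral of [g] over the line becomes that of [S] over the bathtub
     set [F0]. Maximality bounds it by the integral over [F], and the upper bound returns to [g] on
     [F]. So [g] vanishes almost everywhere off [F]. *)
  rewrite -(lerD2r (t * c)) -(Rintegral_bathtub mF0 t0 StF FSt F0c F0t).
  rewrite -Rintegral_mkcond (le_trans (Fmax _ mF0 F0c))//.
  exact: Rintegral_le_posp_sub.
apply: filterS; first exact: (ae_filter_ringOfSetsType mu).
move=> x /(_ I); rewrite patchE; case: ifPn => [/set_mem //|_].
move=> gx0 _; apply: le_trans t_le.
have {}gx0 : Num.max (S x - t) 0 = 0 := gx0.
by rewrite -subr_le0 -gx0 le_max lexx.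
Qed.

Lemma Fstar_rate F theta c : 0 < theta ->
  (mu (superlevel S theta) <= c%:E)%E -> is_Fstar S c F ->
  waterfill_rate S F theta = waterfill_rate S setT theta.
Proof.
move=> theta0 Stheta FF; have [mF _ _] := FF; congr (_ * _).
apply: Rintegral_ae_support => //; first exact: measurable_logp_div.
move: (Fstar_ae_le theta0 Stheta FF).
apply: filterS; first exact: (ae_filter_ringOfSetsType mu).
move=> x /[apply] Sx.
apply/eqP; rewrite eq_le logp_ge0 andbT ge_max lexx andbT.
by rewrite pmulr_lle0 ?invr_gt0 ?ln2_gt0// ln_le0// ler_pdivrMr// mul1r.
Qed.

Lemma Fstar_posp F theta c : 0 < theta ->
  (mu (superlevel S theta) <= c%:E)%E -> is_Fstar S c F ->
  \int[mu]_(x in F) posp (S x - theta) = \int[mu]_x posp (S x - theta).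
Proof.
move=> theta0 Stheta FF; have [mF _ _] := FF.
apply: Rintegral_ae_support => //; first exact: measurable_posp_sub.
move: (Fstar_ae_le theta0 Stheta FF).
apply: filterS; first exact: (ae_filter_ringOfSetsType mu).
move=> x /[apply] Sx.
by rewrite /posp max_r// subr_le0.
Qed.

(** Rests on the pointwise identity [min(s, theta) = s - posp (s - theta)]. *)
Lemma Rintegral_min theta : 0 <= theta ->
  \int[mu]_x Num.min (S x) theta =
  \int[mu]_x S x - \int[mu]_x posp (S x - theta).
Proof.
move=> theta0; rewrite -RintegralB//; last exact: integrable_posp_sub.
apply: eq_Rintegral => x _; rewrite /posp; have [Sx|/ltW Sx] := leP (S x) theta.
  by rewrite max_r ?subr_le0// subr0.
by rewrite max_l ?subr_ge0// subKr.
Qed.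

End water_filling.

(** * Nonnegativity and integrability of the conditional density *)

Section conditional_psd.
Context {R : realType} {SX Se : R -> R}.
Context (SX_ge0 : forall x, 0 <= SX x) (Se_ge0 : forall x, 0 <= Se x).
Context (int_SX : mu.-integrable setT (EFin \o SX)).
Context (int_Se : mu.-integrable setT (EFin \o Se)).

Lemma cond_psd_ge0 x : 0 <= cond_psd SX Se x.
Proof.
by rewrite /cond_psd; case: ifP => // _; rewrite divr_ge0 ?exprn_ge0 ?addr_ge0.
Qed.

Lemma cond_psd_le x : cond_psd SX Se x <= SX x.
Proof.
rewrite /cond_psd; case: eqP => [->//|/eqP SX0].
have SX_gt0 : 0 < SX x by rewrite lt_neqAle eq_sym SX0 SX_ge0.
rewrite ler_pdivrMr ?ltr_pwDl// expr2 ler_pM2l// lerDl.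
exact: Se_ge0.
Qed.

Lemma integrable_cond_psd : mu.-integrable setT (EFin \o cond_psd SX Se).
Proof.
have mSX : measurable_fun setT SX.
  by apply/measurable_EFinP; exact: measurable_int int_SX.
have mSe : measurable_fun setT Se.
  by apply/measurable_EFinP; exact: measurable_int int_Se.
apply: (@integrable_le_scale _ _ _ mu setT _ SX 1) => //; last first.
  by move=> x; rewrite ger0_norm ?cond_psd_ge0// mul1r cond_psd_le.
(* Writing the inverse as the power -1 gives measurability from that of [powR]; where [SX] vanishes
   the squared factor supplies the value 0. *)
have -> : cond_psd SX Se = (fun x => SX x ^+ 2 * (SX x + Se x) `^ (-1)).
  apply/funext => x; rewrite powR_inv1 ?addr_ge0// /cond_psd.
  by case: eqP => // ->; rewrite expr0n mul0r.
apply: measurable_funM; first exact: measurable_funX.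
apply: (@measurableT_comp _ _ _ _ _ _ (@powR R ^~ (-1))) => //.
exact: measurable_funD.
Qed.

End conditional_psd.

(** * Comparison of the two distortion functions *)

(** Brings the indirect distortion to the form used for [is_Dstar], with the whole line as the
    set. *)
Lemma idrf_dist_posp (R : realType) (SX Se : R -> R) (theta : R) :
  (forall x, 0 <= cond_psd SX Se x) ->
  mu.-integrable setT (EFin \o cond_psd SX Se) -> 0 <= theta ->
  idrf_dist SX Se theta =
  variance_psd SX - \int[mu]_x posp (cond_psd SX Se x - theta).
Proof. by move=> S0 iS th0; rewrite /idrf_dist Rintegral_min// subrKA. Qed.

(* The first conjunct says that D^*(fs, r) is well defined: a maximizing set
   and a water-level exist, and the value does not depend on their choice. *)
Theorem proposition4 (R : realType) (d : measure_display)
    (T : measurableType d) (P : probability T R)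
    (X eps : R -> {RV P >-> R}) (SX Se : R -> R)
    (gaussX : gaussian_process X) (gausse : gaussian_process eps)
    (meanX : zero_mean X) (meane : zero_mean eps)
    (statX : stationary X) (state : stationary eps)
    (indep : independent_processes X eps)
    (psdX : is_psd X SX) (psde : is_psd eps Se)
    (r D theta : R) (theta_gt0 : 0 < theta)
    (r_theta : r = idrf_rate SX Se theta) (D_r : D = idrf SX Se r) :
  forall fs : R,
    (lebesgue_measure (superlevel (cond_psd SX Se) theta) <= fs%:E)%E ->
    (exists! D', is_Dstar SX Se fs r D') /\
    Dstar SX Se fs r = idrf SX Se r.
Proof.
move=> fs Stheta; case: psdX psde => [SX0 iSX _ _] [Se0 iSe _ _].
have S0 := cond_psd_ge0 SX0 Se0.
have iS := integrable_cond_psd SX0 Se0 iSX iSe.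
set S := cond_psd SX Se in S0 iS Stheta *.
(* Both distortion functions are shown to take the value [V]; each [get] is resolved by existence
   together with uniqueness. *)
pose V := variance_psd SX - \int[mu]_x posp (S x - theta).
have idrfE : idrf SX Se r = V.
  apply: get_unique; first by exists theta; rewrite idrf_dist_posp// ltW.
  move=> D' [t [t0 rt ->]]; rewrite idrf_dist_posp ?(ltW t0)//; congr (_ - _).
  by apply: waterfill_rate_inj => //; rewrite -[LHS]rt r_theta.
have Dstar_V D' : is_Dstar SX Se fs r D' -> D' = V.
  move=> [F [t [FF t0 rt ->]]]; congr (_ - _).
  rewrite -(Fstar_posp S0 iS theta_gt0 Stheta FF); have [mF _ _] := FF.
  apply: waterfill_rate_inj => //.
  by rewrite -[LHS]rt r_theta (Fstar_rate S0 iS theta_gt0 Stheta FF).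
have Dstar_ex : is_Dstar SX Se fs r V.
  have [F FF] := Fstar_exists S0 iS theta_gt0 Stheta.
  exists F, theta; split => //.
    by rewrite r_theta (Fstar_rate S0 iS theta_gt0 Stheta FF).
  by rewrite (Fstar_posp S0 iS theta_gt0 Stheta FF).
split; last by rewrite idrfE; exact: get_unique.
by exists V; split => // D' /Dstar_V.
Qed.
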